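(* For every positive integer $n$, $a_{n,n} = 2F_n$.
   Context: $\mathbb{N}=\{1,2,3,\dots\}$, and $\mathcal{N}$ denotes the collection of finite subsets of $\mathbb{N}$. For $E\in\mathcal{N}$ and $k\in\mathbb{N}$, let $\omega_k(E)=\sum_{i\in E,\, i\neq k}1$, i.e. the number of elements of $E$ different from $k$. For $k,n\in\mathbb{N}$, let $\mathcal{A}_{k,n}=\{E\in\mathcal{N} : E=\emptyset \text{ or } \omega_k(E)<\min E\le \max E\le n\}$ and $a_{k,n}=|\mathcal{A}_{k,n}|$. $(F_n)_{n\ge0}$ is the Fibonacci sequence: $F_0=0$, $F_1=1$, $F_n=F_{n-1}+F_{n-2}$ for $n\ge2$. *)

(* Defs.v *)
From mathcomp Require Import all_boot finmap.
From mathcomp Require Import boolp classical_sets functions cardinality.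

Set Implicit Arguments.
Unset Strict Implicit.
Unset Printing Implicit Defensive.

Local Open Scope fset_scope.
Local Open Scope classical_set_scope.

(* The natural numbers of the statement start at 1, so a finite subset of them
   is a finite set of [nat] that does not contain 0. *)
Definition finite_subsets : set {fset nat} := [set E : {fset nat} | 0 \notin E].

Definition fset_max (E : {fset nat}) : nat := \max_(i <- E) i.

(* [minn] has no neutral element on [nat]: the maximum serves as default value,
   which is harmless as soon as [E] is nonempty (see [fset_minP]). *)
Definition fset_min (E : {fset nat}) : nat :=
  \big[minn/fset_max E]_(i <- E) i.

Definition omega (k : nat) (E : {fset nat}) : nat := \sum_(i <- E | i != k) 1.

Definition Aset (k n : nat) : set {fset nat} :=
  [set E | finite_subsets E /\
     (E = fset0 \/ omega k E < fset_min E /\ fset_min E <= fset_max E <= n)].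

(* [fset_set] returns the empty set on infinite sets; [finite_Aset] shows that
   this case does not occur here. *)
Definition a (k n : nat) : nat := #|` fset_set (Aset k n)|.

Fixpoint fib (n : nat) : nat :=
  match n with
  | 0 => 0
  | 1 => 1
  | (m.+1 as p).+1 => fib p + fib m
  end.

Lemma fset_maxP (E : {fset nat}) : E != fset0 ->
  fset_max E \in E /\ (forall i, i \in E -> i <= fset_max E).
Proof.
move=> E0; have max_ge i : i \in E -> i <= fset_max E.
  by move=> iE; apply: (@leq_bigmax_seq _ _ xpredT id).
split=> //; have [x xE] := fset0Pn _ E0.
suff [//|max0] : fset_max E \in E \/ fset_max E = 0.
  by have := max_ge x xE; rewrite max0 leqn0 => /eqP <-.
rewrite /fset_max big_seq; elim/big_ind: _ => [|m p|i]; [by right| |by left].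
by move=> mE pE; rewrite /maxn; case: ifP.
Qed.

Lemma fset_minP (E : {fset nat}) : E != fset0 ->
  fset_min E \in E /\ (forall i, i \in E -> fset_min E <= i).
Proof.
move=> E0; have [mE _] := fset_maxP E0; rewrite /fset_min.
split.
  rewrite big_seq; elim/big_ind: _ => // x y xE yE.
  by rewrite /minn; case: ifP.
move: (fset_max E) => m i; rewrite -[i \in E]/(i \in enum_fset E).
elim: (enum_fset E) => // x s IH.
rewrite inE big_cons => /orP[/eqP ->|/IH]; first exact: geq_minl.
exact/leq_trans/geq_minr.
Qed.

Lemma finite_Aset (k n : nat) : finite_set (Aset k n).
Proof.
apply: (@sub_finite_set _ _ [set` fpowerset [fset i | i in iota 0 n.+1]]);
  last exact: finite_fset.
move=> E [_ AE] /=; rewrite fpowersetE; apply/fsubsetP => i iE.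
case: AE => [E0|[_ /andP[_ En]]]; first by rewrite E0 inE in iE.
have E0 : E != fset0 by apply/fset0Pn; exists i.
have [_ maxE] := fset_maxP E0.
have iI : i \in iota 0 n.+1 by rewrite mem_iota ltnS (leq_trans (maxE i iE) En).
by apply/imfsetP; exists i.
Qed.

(* Main.v *)
(* Erasing n from E leaves a set S of integers in [1, n-1], all of them larger
   than |S|, and S together with S + {n} accounts for exactly two members of
   A_{n,n}; so a_{n,n} is twice the number of such S.  These satisfy the
   Fibonacci recurrence: if the bound m+2 belongs to S, deleting it and shifting
   the remaining elements down by one gives an arbitrary such set below m. *)
Require Import Defs.
From mathcomp Require Import all_boot.
From mathcomp Require Import finmap.
From mathcomp Require Import classical_sets cardinality.
From mathcomp Require Import zify.

Local Open Scope fset_scope.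

(* The comparison is made with every element rather than with the minimum, so
   that the empty set needs no special treatment. *)
Definition schreier (m : nat) : {fset {fset nat}} :=
  [fset E in fpowerset [fset i in iota 0 m.+1] | all (fun i => #|` E| < i) E].

Lemma schreierP (m : nat) (E : {fset nat}) :
  reflect {in E, forall i, #|` E| < i <= m} (E \in schreier m).
Proof.
rewrite !inE fpowersetE; apply: (iffP andP) => [[/fsubsetP Em /allP EE] i iE|EE].
  have /imfsetP[j jm ij] := Em _ iE; have {jm} : j \in iota 0 m.+1 := jm.
  by rewrite mem_iota -ij; have := EE _ iE; lia.
split; last by apply/allP => i /EE /andP[].
apply/fsubsetP => i /EE im; apply/imfsetP; exists i => //.
by rewrite [_ \in _]mem_iota; lia.
Qed.

Definition shift_add (m : nat) (E : {fset nat}) : {fset nat} :=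
  m.+2 |` [fset i.+1 | i in E].

Lemma mem_imfset_succ (E : {fset nat}) (i : nat) :
  (i.+1 \in [fset j.+1 | j in E]) = (i \in E).
Proof. by rewrite (mem_imfset _ _ succn_inj). Qed.

Lemma card_imfset_succ (E : {fset nat}) : #|` [fset j.+1 | j in E]| = #|` E|.
Proof. by rewrite (card_imfset _ _ succn_inj). Qed.

Lemma schreier_notin (m n : nat) (E : {fset nat}) :
  m < n -> E \in schreier m -> n \notin E.
Proof. by move=> mn /schreierP EE; apply/negP => /EE; lia. Qed.

Lemma shift_add_notin (m : nat) (E : {fset nat}) :
  E \in schreier m -> m.+2 \notin [fset i.+1 | i in E].
Proof. by rewrite mem_imfset_succ; apply: schreier_notin. Qed.

Lemma fsetU1_inj_in (T : choiceType) (x : T) (A B : {fset T}) :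
  x \notin A -> x \notin B -> x |` A = x |` B -> A = B.
Proof. by move=> xA xB AB; rewrite -(fsetU1K xA) AB fsetU1K. Qed.

(** Membership of [x] separates the two pieces, so the union is disjoint. This serves both the
    Fibonacci recurrence and the final doubling. *)
Lemma cardfsU_imfset (T : choiceType) (x : T) (A B : {fset {fset T}})
    (f : {fset T} -> {fset T}) :
  {in A, forall E, x \notin E} -> {in B, forall E, x \in f E} ->
  {in B &, injective f} ->
  #|` A `|` [fset f E | E in B]| = (#|` A| + #|` B|)%N.
Proof.
move=> xA xB f_inj; rewrite cardfsU (_ : _ `&` _ = fset0).
  by rewrite cardfs0 subn0 card_in_imfset.
apply/fsetP => E; rewrite in_fsetI in_fset0; apply/negP => /andP[/xA xE].
by case/imfsetP => S /= /xB xS ES; rewrite ES xS in xE.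
Qed.

Lemma shift_add_inj (m : nat) : {in schreier m &, injective (shift_add m)}.
Proof.
move=> A B Am Bm /(fsetU1_inj_in _ _ _ _ (shift_add_notin _ _ Am)
  (shift_add_notin _ _ Bm)) AB.
by apply/fsetP => i; rewrite -(mem_imfset_succ A) AB mem_imfset_succ.
Qed.

(** Adding [m.+2] raises the cardinality by one, and the shift raises each old element by one, so
    the strict inequalities survive. *)
Lemma shift_add_schreier (m : nat) (E : {fset nat}) :
  E \in schreier m -> shift_add m E \in schreier m.+2.
Proof.
move=> Em; have /schreierP EE := Em; apply/schreierP => i.
rewrite cardfsU1 shift_add_notin // card_imfset_succ add1n in_fset1U.
case/orP => [/eqP ->|/imfsetP[j /= /EE /andP[Ej jm] ->]]; last by rewrite ltnS Ej ltnS leqW.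
(* For the new element the claim reduces to [#|] E| <=
   m[, which any]j[in]E[yields through]#|[E| < j <= m]. *)
rewrite leqnn andbT !ltnS; case: (fset_0Vmem E) => [->|[j /EE /andP[Ej jm]]].
  by rewrite cardfs0.
exact: leq_trans (ltnW Ej) jm.
Qed.

Lemma schreierSS (m : nat) :
  schreier m.+2 = schreier m.+1 `|` [fset shift_add m E | E in schreier m].
Proof.
apply/fsetP => E; rewrite in_fsetU; apply/idP/orP => [/schreierP EE|[]].
- case: (boolP (m.+2 \in E)) => mE; last first.
    left; apply/schreierP => i iE; have := EE _ iE.
    by case: (eqVneq i m.+2) iE => [->|]; [rewrite (negPf mE)|lia].
  right; have Ecard := cardfsD1 m.+2 E; rewrite mE in Ecard.
  pose S := [fset i.-1 | i in E `\ m.+2].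
  (* The predecessor loses nothing: each element of [E] exceeds a cardinality, hence is positive. *)
  have SE : [fset i.+1 | i in S] = E `\ m.+2.
    apply/fsetP => i; apply/imfsetP/idP => [[j /imfsetP[k /= kE ->] ->]|iE].
      by have := kE; rewrite in_fsetD1 => /andP[_ /EE]; case: k kE.
    have := iE; rewrite in_fsetD1 => /andP[_ /EE].
    case: i iE => [|i] iE // _; exists i => //=.
    by apply/imfsetP; exists i.+1.
  apply/imfsetP; exists S => /=; last by rewrite /shift_add SE fsetD1K.
  apply/schreierP => i iS.
  have : i.+1 \in E `\ m.+2 by rewrite -SE mem_imfset_succ.
  (* Here [i.+1] differs from [m.+2], so [i <= m]; the lost element lowers the cardinality by one,
     which pays for the shift. *)
  rewrite -(card_imfset_succ S) SE in_fsetD1 => /andP[im /EE]; lia.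
- by move=> /schreierP EE; apply/schreierP => i /EE; lia.
- by move=> /imfsetP[S /= Sm ->]; apply: shift_add_schreier.
Qed.

Lemma schreier_small (m : nat) : m <= 1 -> schreier m = [fset fset0].
Proof.
move=> m1; apply/fsetP => E; rewrite in_fset1; apply/schreierP/eqP => [EE|-> //].
case: (fset_0Vmem E) => // -[i iE]; have := EE _ iE.
have : 0 < #|` E| by rewrite cardfs_gt0; apply/fset0Pn; exists i.
lia.
Qed.

Lemma card_schreier (m : nat) : #|` schreier m| = fib m.+1.
Proof.
(* The recurrence reaches back two steps, so two consecutive values are carried through the
   induction. *)
suff: #|` schreier m| = fib m.+1 /\ #|` schreier m.+1| = fib m.+2 by case.
elim: m => [|m [IH IHS]]; first by rewrite !schreier_small // cardfs1.
split=> //; rewrite schreierSS (@cardfsU_imfset _ m.+2) ?IH ?IHS //.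
- by move=> E; apply: schreier_notin.
- by move=> E _; rewrite in_fset1U eqxx.
- exact: shift_add_inj.
Qed.

Lemma omegaE (k : nat) (E : {fset nat}) : omega k E = #|` E `\ k|.
Proof.
rewrite /omega sum1_count -size_filter; apply: perm_size.
apply: uniq_perm => [| |i]; rewrite ?filter_uniq ?fset_uniq //.
by rewrite mem_filter [RHS]in_fsetD1.
Qed.

(** The elementwise condition is vacuous on the empty set and forces positivity, so it absorbs both
    the special case and the exclusion of 0. *)
Lemma AsetP (k n : nat) (E : {fset nat}) :
  Aset k n E <-> {in E, forall i, #|` E `\ k| < i <= n}.
Proof.
rewrite -omegaE; split=> [[_ [->//|[lt_min /andP[_ max_le]]] i iE]|EE].
  have E0 : E != fset0 by apply/fset0Pn; exists i.
  have [_ /(_ _ iE)] := fset_maxP E0; have [_ /(_ _ iE)] := fset_minP E0; lia.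
split; first by apply/negP => /EE.
have [->|E0] := eqVneq E fset0; [by left|right].
have [maxE max_ge] := fset_maxP E0; have [minE _] := fset_minP E0.
by have := EE _ maxE; have := EE _ minE; have := max_ge _ minE; lia.
Qed.

Lemma Aset_diag (m : nat) :
  Aset m.+1 m.+1 =
  [set` (schreier m `|` [fset m.+1 |` S | S in schreier m])%fset]%classic.
Proof.
apply/seteqP; split=> E /=; rewrite in_fsetU.
- move=> /AsetP EE.
  have Sm : E `\ m.+1 \in schreier m.
    by apply/schreierP => i; rewrite in_fsetD1 => /andP[im /EE]; lia.
  case: (boolP (m.+1 \in E)) => mE; apply/orP; last by left; rewrite mem_fsetD1 in Sm.
  by right; apply/imfsetP; exists (E `\ m.+1) => //=; rewrite fsetD1K.
- case/orP => [Em|/imfsetP[S /= Sm ->]]; apply/AsetP => i.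
    rewrite mem_fsetD1; last exact: schreier_notin Em.
    by move: Em => /schreierP /[apply]; lia.
  rewrite fsetU1K; last exact: schreier_notin Sm.
  move: Sm => /schreierP SS; rewrite in_fset1U => /orP[/eqP ->|/SS]; last by lia.
  by case: (fset_0Vmem S) => [->|[j /SS]]; [rewrite cardfs0 leqnn|lia].
Qed.

Theorem theorem1p1 (n : nat) (hn : 0 < n) : a n n = 2 * fib n.
Proof.
case: n hn => // m _; rewrite /a Aset_diag set_fsetK (@cardfsU_imfset _ m.+1).
- by rewrite card_schreier addnn mul2n.
- by move=> E; apply: schreier_notin.
- by move=> E _; rewrite in_fset1U eqxx.
- move=> A B Am Bm; apply: fsetU1_inj_in.
    exact: schreier_notin Am.
  exact: schreier_notin Bm.
Qed.
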